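(* Let $X$ be a nonzero real Banach space. An operator $T:\mathscr{C}(X)\to\mathscr{C}(X)$ is fully order preserving if and only if there exist $c\in X$, $w\in X^*$, $\beta\in\mathbb{R}$, $\tau\in\mathbb{R}$ with $\tau>0$, and a continuous automorphism $E$ of $X$ such that $$T(f)(x)=\tau f(Ex+c)+\langle w,x\rangle+\beta$$ for all $f\in\mathscr{C}(X)$ and all $x\in X$.
   Context: $X^*$ is the topological dual of $X$ and $\langle u,x\rangle=u(x)$ for $u\in X^*$, $x\in X$. $\mathscr{C}(X)$ is the set of proper (not identically $+\infty$), convex, (norm) lower semicontinuous functions $f:X\to\mathbb{R}\cup\{+\infty\}$, ordered pointwise: $f\le g$ iff $f(x)\le g(x)$ for all $x\in X$. An operator $T:\mathscr{C}(X)\to\mathscr{C}(X)$ (an arbitrary map) is fully order preserving if it is onto and, for all $f,g\in\mathscr{C}(X)$, $f\le g$ if and only if $T(f)\le T(g)$. A continuous automorphism of $X$ is a continuous linear bijection $X\to X$. *)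

(* Defs.v *)
From mathcomp Require Import all_boot all_order all_algebra.
From mathcomp Require Import all_classical all_reals all_analysis.

Set Implicit Arguments.
Unset Strict Implicit.
Unset Printing Implicit Defensive.

Import Order.TTheory GRing.Theory Num.Theory.
Import numFieldNormedType.Exports.

Local Open Scope classical_set_scope.
Local Open Scope ring_scope.
Local Open Scope ereal_scope.

(* Extended-valued analogue of [convex_function]. It is only used for
   functions avoiding -oo, so the right-hand side never contains the
   indeterminate +oo + -oo; the endpoints t = 0 and t = 1 are harmless
   because 0 * +oo = 0 in \bar R. *)
Definition econvex_function (R : realType) (X : lmodType R)
    (f : X -> \bar R) : Prop :=
  forall (x y : X) (t : R), (0 <= t <= 1)%R ->
    f (t *: x + (1 - t) *: y)%R <= t%:E * f x + (1 - t)%:E * f y.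

Record convex_lsc (R : realType) (X : normedModType R) := ConvexLsc {
  convex_lsc_fun :> X -> \bar R ;
  convex_lsc_gtNy : forall x, -oo < convex_lsc_fun x ;
  convex_lsc_proper : exists x, convex_lsc_fun x < +oo ;
  convex_lsc_convex : econvex_function convex_lsc_fun ;
  convex_lsc_lsc : lower_semicontinuous convex_lsc_fun
}.

Definition pointwise_le (R : realType) (X : normedModType R)
    (f g : convex_lsc X) : Prop :=
  forall x, f x <= g x.

Definition fully_order_preserving (R : realType) (X : normedModType R)
    (T : convex_lsc X -> convex_lsc X) : Prop :=
  (forall g, exists f, T f = g) /\
  (forall f g, pointwise_le f g <-> pointwise_le (T f) (T g)).

Definition continuous_automorphism (R : realType) (X : normedModType R)
    (E : {linear X -> X}) : Prop :=
  continuous E /\ bijective E.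

(* Main.v *)
(* Let point x a be the function equal to a at x and +oo elsewhere. These are
   exactly the functions whose set of majorants is a chain, so T permutes them:
   T (point x a) = point (phi x) (psi x a). Since f <= point x a iff f x <= a,
   this gives T f (phi x) = psi x (f x) for every f, with psi x an increasing
   bijection of R. The least convex function above two points is affine on a
   segment; hence phi preserves segments and, when phi maps t p + (1 - t) q to
   s phi p + (1 - s) phi q, with z = t p + (1 - t) q,
     psi z (t a + (1 - t) b) = s psi p a + (1 - s) psi q b.
   This Pexider equation forces psi x a = tau x * a + beta x, and comparing
   coefficients shows that 1 / tau is affine along lines; being positive, it is
   constant. Then s = t, so phi and beta are affine. Continuity of the linear
   parts comes from lower semicontinuity of T 0 and T `|.|, with Baire's theorem
   for the latter; surjectivity in the converse needs the bounded inverse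
   theorem. *)

From HB Require Import structures.
Require Import Defs.
From mathcomp Require Import all_boot all_order all_algebra.
From mathcomp Require Import all_classical all_reals all_analysis.
From mathcomp Require Import ring lra.

Set Implicit Arguments.
Unset Strict Implicit.
Unset Printing Implicit Defensive.

Import Order.TTheory GRing.Theory Num.Theory.
Import numFieldNormedType.Exports.

Local Open Scope classical_set_scope.
Local Open Scope ring_scope.

(** * Closed covers and the bounded inverse theorem *)

Section banach.
Context {R : realType} {X : completeNormedModType R}.

(** Otherwise every complement is open and dense, so by Baire their intersection is dense, hence
    nonempty, against the covering. *)
Lemma Baire_closed_cover (F : (set X)^nat) :
  (forall n, closed (F n)) -> \bigcup_n F n = setT ->
  exists n x (r : {posnum R}), ball x r%:num `<=` F n.
Proof.
move=> clF covF.
have [n] : exists n, ~ dense (~` F n).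
  apply/existsNP => denseC.
  have : dense (\bigcap_n ~` F n).
    by apply: Baire => n; split; [exact: closed_openC | exact: denseC].
  rewrite -setC_bigcup covF setCT => /(_ setT) [|//|x []//].
    by exists 0.
  exact: openT.
move=> /denseNE [U [[x xU] UF]].
have /nbhs_ballP[r r0 rU] := open_nbhs_nbhs xU.
exists n, x, (PosNum r0) => y /rU Uy.
apply: contrapT => nFy; have : (U `&` ~` F n) y by [].
by rewrite UF.
Qed.

(** By Baire a bound [n] holds on a ball around some [x]; subtracting the values at [x + y] and [x]
    cancels [c] and bounds [E] by [2n] near 0. *)
Lemma closed_norm_continuous (E : {linear X -> X}) (c : X) :
  (forall a : R, closed [set x | `|E x + c| <= a]) -> continuous E.
Proof.
move=> clE.
have [|n [x [r rF]]] := Baire_closed_cover (fun n => clE n%:R).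
  apply/seteqP; split=> // x _; exists (Num.truncn `|E x + c|).+1 => //=.
  exact/ltW/truncnS_gt.
apply: bounded_linear_continuous; apply/ex_bound; exists (n + n)%:R.
apply/nbhs_ballP; exists r%:num => //= y.
rewrite -ball_normE /= sub0r normrN => yr.
have -> : E y = (E (x + y) + c) - (E x + c).
  by rewrite linearD opprD addrACA subrr addr0 addrAC subrr add0r.
rewrite (le_trans (ler_normB _ _))// natrD lerD//; apply: rF.
  by rewrite -ball_normE /= opprD addNKr normrN.
exact: ballxx.
Qed.

(** First half of the open mapping argument: closures of images of balls cover the space, one of
    them contains a ball, and differences recentre that ball at 0. Working with closures costs the
    error [|y| / 2]. *)
Lemma approximate_preimage (E : {linear X -> X}) : bijective E ->
  exists2 C : R, 0 <= C &
    forall y, exists x, `|x| <= C * `|y| /\ `|y - E x| <= `|y| / 2.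
Proof.
move=> [E' EK E'K].
have [|n [y0 [r rF]]] := Baire_closed_cover
    (fun n => @closed_closure _ (E @` [set x : X | `|x| <= n%:R])).
  apply/seteqP; split=> // y _; exists (Num.truncn `|E' y|).+1 => //=.
  apply: subset_closure; exists (E' y) => //=.
  exact/ltW/truncnS_gt.
have approx y e : `|y| < r%:num -> 0 < e ->
    exists2 x, `|x| <= (n + n)%:R & `|y - E x| <= e.
  move=> yr e0.
  have e20 : 0 < e / 2 by rewrite divr_gt0.
  have [|_ [[x1 x1n <-] x1e]] := rF (y0 + y) _ _ (nbhsx_ballx _ _ e20).
    by rewrite -ball_normE /= opprD addNKr normrN.
  have [|_ [[x0 x0n <-] x0e]] := rF y0 _ _ (nbhsx_ballx _ _ e20).
    exact: ballxx.
  exists (x1 - x0); first by rewrite (le_trans (ler_normB _ _))// natrD lerD.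
  have -> : y - E (x1 - x0) = (y0 + y - E x1) - (y0 - E x0).
    rewrite linearB !opprB (addrC y0) -!addrA; congr (y + _).
    by rewrite [RHS]addrC -!addrA addNr addr0 addrC.
  move: x0e x1e; rewrite -!ball_normE /= => x0e x1e.
  by rewrite (le_trans (ler_normB _ _))//; lra.
exists ((n + n)%:R * 2 / r%:num) => [|y]; first by rewrite !mulr_ge0.
have [->|y0'] := eqVneq y 0.
  by exists 0; rewrite linear0 subr0 !normr0 mulr0 mul0r.
have ny0 : 0 < `|y| by rewrite normr_gt0.
(* The factor [k] brings [y] to norm [r / 2], inside the ball; the error [r / 4] scales back to
   [|y| / 2]. *)
pose k := r%:num / 2 / `|y|.
have k0 : 0 < k by rewrite !divr_gt0.
have [||x xn xe] := approx (k *: y) (r%:num / 4).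
- rewrite normrZ gtr0_norm// /k divfK ?gt_eqF//.
  by rewrite ltr_pdivrMr// ltr_pMr// ltr1n.
- by rewrite divr_gt0.
exists (k^-1 *: x); split.
  rewrite normrZ gtr0_norm ?invr_gt0// mulrC ler_pdivrMr//.
  rewrite (le_trans xn)// /k.
  suff -> : (n + n)%:R * 2 / r%:num * `|y| * (r%:num / 2 / `|y|) =
    (n + n)%:R :> R by [].
  by field; rewrite !gt_eqF.
have -> : y - E (k^-1 *: x) = k^-1 *: (k *: y - E x).
  by rewrite scalerBr scalerA mulVf ?gt_eqF// scale1r linearZ.
rewrite normrZ gtr0_norm ?invr_gt0// mulrC ler_pdivrMr// (le_trans xe)// /k.
suff -> : `|y| / 2 * (r%:num / 2 / `|y|) = r%:num / 4 :> R by [].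
by field; rewrite gt_eqF.
Qed.

(** Second half: the corrections [g (v n)] halve the residual [v n] each time, so their series
    converges absolutely, its sum is [E' y], and the norm is at most [2 C |y|]. *)
Lemma bounded_inverse (E E' : {linear X -> X}) :
  continuous E -> cancel E E' -> cancel E' E -> continuous E'.
Proof.
move=> ctsE EK E'K.
have [|C C0 /choice[g gP]] := @approximate_preimage E; first by exists E'.
apply: bounded_linear_continuous; apply/ex_bound; exists (C * 2).
apply/nbhs_ballP; exists 1 => //= y; rewrite -ball_normE /= sub0r normrN => y1.
pose v n := iter n (fun z => z - E (g z)) y.
have vS n : v n.+1 = v n - E (g (v n)) by [].
have vle n : `|v n| <= `|y| / 2 ^+ n.
  elim: n => [|n IH]; first by rewrite expr0 divr1.
  rewrite vS (le_trans (gP _).2)// exprS invfM mulrA mulrAC.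
  by rewrite ler_wpM2r.
pose x n := g (v n).
have xle n : `|x n| <= (C * `|y|) / 2 ^+ n.
  by rewrite (le_trans (gP _).1)// -mulrA ler_wpM2l.
have vcvg : v @ \oo --> (0 : X).
  apply/norm_cvg0P.
  apply: (@squeeze_cvgr _ _ _ _ (cst 0) (geometric `|y| 2^-1)).
  - by apply: nearW => n; rewrite normr_ge0/= exprVn vle.
  - exact: cvg_cst.
  - by apply: cvg_geometric; rewrite gtr0_norm ?invf_lt1 ?ltr1n.
have ncvg : cvgn [normed series x].
  apply: (@series_le_cvg _ _ (geometric (C * `|y|) 2^-1)).
  - by move=> n /=.
  - by move=> n; rewrite geometric_ge0// mulr_ge0.
  - by move=> n /=; rewrite exprVn.
  - by apply: is_cvg_geometric_series; rewrite gtr0_norm ?invf_lt1 ?ltr1n.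
have := normed_cvg ncvg => /cvg_ex[/= l xl].
have ES n : E (series x n) = y - v n.
  elim: n => [|n IH]; first by rewrite seriesEnat/= big_geq// linear0 subrr.
  by rewrite seriesSr linearD IH vS opprB addrA addrAC.
have -> : E' y = l.
  rewrite -[RHS]EK; congr (E' _).
  apply: (@cvg_unique _ _ (y - v n @[n --> \oo])).
  - exact: norm_hausdorff.
  - by have := cvgB (cvg_cst y) vcvg; rewrite subr0; exact.
  - rewrite -(funext ES); apply: continuous_cvg; last exact: xl.
    exact: ctsE.
have lim_le : `|l| <= C * `|y| * 2.
  have clB : closed [set z : X | `|z| <= C * `|y| * 2].
    apply: (@preimage_closed X R (fun z => `|z|) [set t | t <= C * `|y| * 2]).
      by move=> z _; exact: norm_continuous.
    exact: closed_le.
  apply: (@closed_cvg _ _ \oo eventually_filter (series x) _ clB _ l xl).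
  apply: nearW => n /=.
  (* The intermediate bound is the geometric partial sum, which, unlike its limit, passes through
     the induction. *)
  rewrite (@le_trans _ _ (C * `|y| * 2 * (1 - 2^-1 ^+ n)))//; last first.
    by rewrite ler_piMr ?mulr_ge0// lerBlDr lerDl exprn_ge0.
  elim: n => [|n IH].
    by rewrite seriesEnat/= big_geq// normr0 expr0 subrr mulr0.
  rewrite seriesSr (le_trans (ler_normD _ _))// (le_trans (lerD IH (xle n)))//.
  by rewrite -exprVn exprS; lra.
by rewrite (le_trans lim_le)// mulrAC ler_piMr ?mulr_ge0// ltW.
Qed.

End banach.

(** * Convex lower semicontinuous functions *)

Section convex_lsc_functions.
Context {R : realType}.

(** Convexity of the epigraph: for [0 < t < 1] an infinite value makes the right-hand side infinite,
    so only real bounds matter. The endpoints are split off because there [0 * +oo = 0]. *)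
Lemma econvex_real (Y : lmodType R) (f : Y -> \bar R) :
  (forall x, -oo < f x)%E ->
  (forall x y (t r s : R), 0 <= t <= 1 -> (f x <= r%:E)%E -> (f y <= s%:E)%E ->
    (f (t *: x + (1 - t) *: y)%R <= (t * r + (1 - t) * s)%:E)%E) ->
  econvex_function f.
Proof.
move=> fNy cf x y t t01.
have [->|t0] := eqVneq t 0.
  by rewrite scale0r add0r subr0 scale1r mul0e add0e mul1e.
have [->|t1] := eqVneq t 1.
  by rewrite scale1r subrr scale0r addr0 mul0e mul1e adde0.
have tgt0 : 0 < t by rewrite lt_def t0; case/andP: t01.
have tlt1 : 0 < 1 - t by rewrite subr_gt0 lt_neqAle t1; case/andP: t01.
have := fNy x; have := fNy y.
case fx : (f x) => [r| |]; case fy : (f y) => [s| |] // _ _;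
  rewrite ?gt0_muley ?gt0_mulye ?lte_fin// ?leey//.
by rewrite -!EFinM -EFinD; apply: cf; rewrite ?fx ?fy.
Qed.

Lemma econvex_le (Y : lmodType R) (f : Y -> \bar R) x y (t r s : R) :
  econvex_function f ->
  0 <= t <= 1 -> (f x <= r%:E)%E -> (f y <= s%:E)%E ->
  (f (t *: x + (1 - t) *: y)%R <= (t * r + (1 - t) * s)%:E)%E.
Proof.
move=> cf /[dup] t01 /andP[t0 t1] fx fy; apply: (le_trans (cf _ _ _ t01)).
by rewrite [leRHS]EFinD !EFinM leeD// lee_wpmul2l// lee_fin ?subr_ge0.
Qed.

Lemma convex_lsc_ext (X : normedModType R) (f g : convex_lsc X) :
  f =1 g -> f = g.
Proof.
case: f g => [f fNy fp fc fl] [g gNy gp gc gl] /= /funext fg.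
by rewrite fg in fNy fp fc fl *; congr ConvexLsc; exact: Prop_irrelevance.
Qed.

(** A real [b < g (A x)] with [a < k * b + u x] splits the strict inequality into two open
    conditions, one through [A] and one on [u]. *)
Lemma lower_semicontinuous_affine_change (X : normedModType R) (A : X -> X)
    (u : X -> R) (k : R) (g : X -> \bar R) :
  continuous A -> continuous u -> 0 < k -> lower_semicontinuous g ->
  lower_semicontinuous (fun x => k%:E * g (A x) + (u x)%:E)%E.
Proof.
move=> cA cu k0 /lower_semicontinuousP lg x a agx.
have [b bg abu] : exists2 b, (b%:E < g (A x))%E & a < k * b + u x.
  case gx : (g (A x)) agx => [r| |].
  - rewrite -EFinM -EFinD lte_fin -ltrBlDr => ar.
    have {ar}ar : (a - u x) / k < r by rewrite ltr_pdivrMr// mulrC.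
    exists ((r + (a - u x) / k) / 2); first by rewrite lte_fin; lra.
    by rewrite -ltrBlDr mulrC -ltr_pdivrMr//; lra.
  - move=> _; exists ((a - u x) / k + 1); first exact: ltry.
    have -> : k * ((a - u x) / k + 1) = a - u x + k by field; rewrite gt_eqF.
    lra.
  - by rewrite gt0_muleNy ?lte_fin// addNye.
have oA : open (A @^-1` [set y | b%:E < g y]%E).
  by apply: open_comp (lg b) => y _; exact: cA.
have ou : open (u @^-1` [set r | a - k * b < r]).
  apply: (@open_comp X R u [set r | a - k * b < r]); last exact: open_gt.
  by move=> y _; exact: cu.
exists ((A @^-1` [set y | b%:E < g y]%E) `&` (u @^-1` [set r | a - k * b < r])).
  apply: open_nbhs_nbhs; split; first exact: openI.
  by split => //=; rewrite ltrBlDl.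
move=> y [/= bgy auy].
apply: (@lt_le_trans _ _ (k * b + u y)%:E).
  by rewrite lte_fin -ltrBlDl.
by rewrite EFinD EFinM leeD2r// lee_wpmul2l ?lee_fin// ltW.
Qed.

(** Restricted to [t] in [0, 1], which is all that segments provide; [convex_affine_linear] recovers
    a linear map. *)
Definition convex_affine (Y Z : lmodType R) (A : Y -> Z) :=
  forall x y (t : R), 0 <= t <= 1 ->
    A (t *: x + (1 - t) *: y) = t *: A x + (1 - t) *: A y.

(** Supplies the preimages under [T] in the converse. Real bounds on [f] translate into real bounds
    on [g], which transports convexity; surjectivity of [A] gives properness. *)
Lemma affine_change (X : normedModType R) (A : X -> X) (u : X -> R^o) (k : R)
    (g : convex_lsc X) :
  continuous A -> continuous u -> 0 < k -> convex_affine A -> convex_affine u ->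
  (forall y, exists x, A x = y) ->
  exists f : convex_lsc X, forall x, f x = (k%:E * g (A x) + (u x)%:E)%E.
Proof.
move=> cA cu k0 aA au sA.
pose f x := (k%:E * g (A x) + (u x)%:E)%E.
have fle x r : (f x <= r%:E)%E = (g (A x) <= ((r - u x) / k)%:E)%E.
  by rewrite -leeBrDr// -EFinB -lee_pdivlMl// -EFinM mulrC.
have fNy x : (-oo < f x)%E.
  rewrite /f; have := convex_lsc_gtNy g (A x).
  case: (g (A x)) => [r _| _|//]; first by rewrite -EFinM -EFinD ltNyr.
  by rewrite gt0_muley ?lte_fin// addye.
have fp : exists x, (f x < +oo)%E.
  have [y gy] := convex_lsc_proper g; have [x Ax] := sA y; exists x.
  rewrite /f Ax; have := convex_lsc_gtNy g y.
  by case: (g y) gy => [r| |]// _ _; rewrite -EFinM -EFinD ltry.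
have fc : econvex_function f.
  apply: econvex_real => // x y t r s t01; rewrite !fle => gx gy.
  rewrite aA// au//.
  have := econvex_le (@convex_lsc_convex _ _ g) t01 gx gy.
  move/le_trans; apply; rewrite lee_fin le_eqVlt; apply/orP; left; apply/eqP.
  by rewrite /GRing.scale /=; field; rewrite gt_eqF.
have fl : lower_semicontinuous f.
  exact: lower_semicontinuous_affine_change (@convex_lsc_lsc _ _ g).
by exists (ConvexLsc fNy fp fc fl).
Qed.

(** * Functions affine on a segment and infinite off it *)

Section segment.
Variables (X : normedModType R) (p q : X) (a b : R).

Definition segment_point (t : R) : X := t *: p + (1 - t) *: q.

Lemma segment_point_inj t s : p != q ->
  segment_point t = segment_point s -> t = s.
Proof.
move=> pq /eqP; rewrite -subr_eq0 /segment_point.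
have -> : t *: p + (1 - t) *: q - (s *: p + (1 - s) *: q) = (t - s) *: (p - q).
  rewrite opprD addrACA -scalerBl -scalerBl scalerBr; congr (_ + _).
  by rewrite -scaleNr; congr (_ *: _); ring.
by rewrite scaler_eq0 !subr_eq0 (negPf pq) orbF => /eqP.
Qed.

(* With p = q the segment degenerates to a point, which is how the one-point
   functions are obtained. *)
Hypothesis pq : p = q -> a = b.

(** Off the segment the set is empty, so the infimum is [+oo]; on it all admissible parameters give
    the same value. *)
Definition segment_fun (z : X) : \bar R :=
  ereal_inf [set (t * a + (1 - t) * b)%:E |
             t in [set t | 0 <= t <= 1 /\ segment_point t = z]].

Lemma segment_funE t : 0 <= t <= 1 ->
  segment_fun (segment_point t) = (t * a + (1 - t) * b)%:E.
Proof.
move=> t01; rewrite /segment_fun.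
rewrite (_ : image _ _ = [set (t * a + (1 - t) * b)%:E]) ?ereal_inf1//.
apply/seteqP; split=> [_ [s [s01 st] <-]|_ ->]; last by exists t.
have [/pq ab|/segment_point_inj/(_ st) -> //] := eqVneq p q.
by rewrite ab /=; congr EFin; ring.
Qed.

Lemma segment_fun_fin z : (segment_fun z < +oo)%E ->
  exists2 t, 0 <= t <= 1 & z = segment_point t.
Proof.
move=> /ereal_inf_lt [_ [t [t01 <-] _] _].
by exists t.
Qed.

Lemma segment_fun_gtNy z : (-oo < segment_fun z)%E.
Proof.
have [/segment_fun_fin [t t01 ->]|] := ltP (segment_fun z) +oo%E.
  by rewrite segment_funE// ltNyr.
by apply: lt_le_trans.
Qed.

Lemma segment_fun_proper : exists z, (segment_fun z < +oo)%E.
Proof.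
by exists (segment_point 0); rewrite segment_funE ?lexx ?ler01// ltry.
Qed.

Lemma segment_fun_convex : econvex_function segment_fun.
Proof.
apply: econvex_real => [z|x y t r s t01 fx fy]; first exact: segment_fun_gtNy.
have [t1 t101 xt] := segment_fun_fin (le_lt_trans fx (ltry _)).
have [t2 t201 yt] := segment_fun_fin (le_lt_trans fy (ltry _)).
move: fx fy; rewrite xt yt !segment_funE// !lee_fin => fx fy.
have -> : t *: segment_point t1 + (1 - t) *: segment_point t2 =
          segment_point (t * t1 + (1 - t) * t2).
  rewrite /segment_point !scalerDr !scalerA addrACA -!scalerDl.
  by congr (_ + _ *: _); ring.
by rewrite segment_funE ?lee_fin; nra.
Qed.

(** Each sublevel set is the continuous image of a compact set of parameters, hence closed. *)
Lemma segment_fun_lsc : lower_semicontinuous segment_fun.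
Proof.
apply/lower_semicontinuousP => r.
have cseg : continuous segment_point.
  move=> t; apply: cvgD; first by apply: cvgZr_tmp; exact: cvg_id.
  by apply: cvgZr_tmp; apply: cvgB; [exact: cvg_cst|exact: cvg_id].
have cval : continuous (fun t : R => t * a + (1 - t) * b).
  move=> t; apply: cvgD; first by apply: cvgMr_tmp; exact: cvg_id.
  by apply: cvgMr_tmp; apply: cvgB; [exact: cvg_cst|exact: cvg_id].
rewrite (_ : mkset _ = ~` (segment_point @`
    (`[0, 1] `&` (fun t => t * a + (1 - t) * b) @^-1` [set s | s <= r]))).
  apply: closed_openC; apply: compact_closed; first exact: norm_hausdorff.
  apply: continuous_compact; first exact: continuous_subspaceT.
  apply: compact_closedI; first exact: segment_compact.
  apply: (@preimage_closed _ R _ [set s | s <= r]); last exact: closed_le.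
  by move=> t _; exact: cval.
rewrite -[LHS]setCK; congr (~` _).
apply/seteqP; split=> [z|_ [t [t01 tr] <-]] /=.
  move=> /negP; rewrite -leNgt => zr.
  have [t t01 zt] := segment_fun_fin (le_lt_trans zr (ltry _)).
  move: zr; rewrite zt segment_funE// lee_fin => zr.
  by exists t => //; split => //=; rewrite in_itv.
by apply/negP; rewrite -leNgt segment_funE ?lee_fin.
Qed.

Definition segment_convex_lsc : convex_lsc X :=
  ConvexLsc segment_fun_gtNy segment_fun_proper segment_fun_convex
    segment_fun_lsc.

End segment.
End convex_lsc_functions.

(** * The fibre maps *)

Lemma monotone_additive_linear (R : realType) (f : R -> R) :
  {homo f : a b / a <= b} -> {morph f : a b / a + b} ->
  forall a, f a = a * f 1.
Proof.
move=> fm fD a.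
have f0 : f 0 = 0 by have := fD 0 0; rewrite addr0; lra.
have f10 : 0 <= f 1 by rewrite -f0 fm.
have fN b : f (- b) = - f b by have := fD b (- b); rewrite subrr f0; lra.
have fn n b : f (n%:R * b) = n%:R * f b.
  elim: n => [|n IH]; first by rewrite !mul0r.
  by rewrite -natr1 !mulrDl !mul1r fD IH.
(* The additive function f b - b * f 1 vanishes on the integers, hence is
   bounded, hence zero. *)
have bound b : `|f b - b * f 1| <= f 1.
  have [z zb] : exists z : int, z%:~R <= b < (z + 1)%:~R.
    by exists (Num.floor b); rewrite floor_le floorD1_gt.
  have fz : forall m : int, f m%:~R = m%:~R * f 1.
    case=> n; first by have := fn n 1; rewrite !mulr1.
    by rewrite NegzE mulrNz fN; have := fn n.+1 1; rewrite mulr1 mulNr => <-.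
  case/andP: zb => zb1 zb2; have := fm _ _ zb1; have := fm _ _ (ltW zb2).
  rewrite !fz intrD; rewrite intrD in zb2 => h1 h2; rewrite ler_norml.
  apply/andP; split; nra.
apply/eqP; rewrite -subr_eq0; apply/negPn/negP => d0.
have d_gt0 : 0 < `|f a - a * f 1| by rewrite normr_gt0.
(* Passing from [a] to [n * a] multiplies the defect by [n], beyond the uniform bound [f 1]. *)
pose n := (Num.truncn (f 1 / `|f a - a * f 1|)).+1.
have := bound (n%:R * a); rewrite fn -mulrA -mulrBr normrM ger0_norm// leNgt.
by rewrite -ltr_pdivrMr// truncnS_gt.
Qed.

Section fibre_maps.
Context {R : realType} {X : lmodType R}.
Variables (phi : X -> X) (psi : X -> R -> R).
Hypotheses (X_neq0 : exists x : X, x != 0) (phi_inj : injective phi)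
  (psi_mono : forall x, {mono psi x : a b / a <= b}).
Hypothesis psi_segment : forall p q (t : R), p != q -> 0 <= t <= 1 ->
  exists2 s : R, 0 <= s <= 1 &
    phi (t *: p + (1 - t) *: q) = s *: phi p + (1 - s) *: phi q /\
    forall a b : R, psi (t *: p + (1 - t) *: q) (t * a + (1 - t) * b) =
      s * psi p a + (1 - s) * psi q b.

(** At a midpoint only the sum of the two heights matters. Comparing [(a + h, - a)] with [(h, 0)],
    and [(a, - a)] with [(0, 0)], eliminates the other two fibre maps and makes [psi x a - psi x 0]
    additive, hence linear by monotonicity. *)
Let fibre_affine x :
  exists k : R * R, 0 < k.1 /\ forall a, psi x a = k.1 * a + k.2.
Proof.
have [e e0] := X_neq0.
have xq : x != x + e by rewrite -subr_eq0 opprD addNKr oppr_eq0.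
have [|s s01 [phiz psiz]] := psi_segment (t := 1/2) xq; first by lra.
(* With [s = 0] the midpoint and the endpoint [x + e] would have the same image under [phi]. *)
have s0 : s != 0.
  apply/eqP => s0; move: phiz; rewrite s0 scale0r add0r subr0 scale1r.
  move=> /phi_inj /eqP; rewrite scalerDr addrA -scalerDl addrC.
  have -> : 1 / 2 + (1 - 1 / 2) = 1 :> R by lra.
  rewrite scale1r (addrC x) -subr_eq0 opprD addrACA subrr addr0.
  rewrite -[X in _ - X]scale1r -scalerBl scaler_eq0 (negPf e0) orbF.
  by rewrite subr_eq0 => /eqP; lra.
pose g a := psi x a - psi x 0.
have gD : {morph g : a b / a + b}.
  move=> a h; rewrite /g.
  have h1 := psiz (a + h) (- a); have h2 := psiz a (- a).
  have h3 := psiz h 0; have h4 := psiz 0 0.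
  have e1 : 1 / 2 * (a + h) + (1 - 1 / 2) * - a = 1 / 2 * h + (1 - 1 / 2) * 0.
    by field.
  have e2 : 1 / 2 * a + (1 - 1 / 2) * - a = 1 / 2 * 0 + (1 - 1 / 2) * 0 :> R.
    by field.
  rewrite e1 h3 in h1; rewrite e2 h4 in h2.
  by apply: (mulfI s0); rewrite !(mulrDr, mulrN); lra.
have gm : {homo g : a b / a <= b} by move=> a b ab; rewrite lerD2r psi_mono.
exists (g 1, psi x 0); split => [|a] /=.
  rewrite subr_gt0 lt_neqAle psi_mono ler01 andbT.
  by rewrite (inj_eq (inc_inj (psi_mono x))) eq_sym oner_eq0.
by rewrite mulrC -(monotone_additive_linear gm gD) subrK.
Qed.

Lemma fibre_maps_affine : exists (tau : R) (beta : X -> R^o),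
  [/\ 0 < tau, forall x a, psi x a = tau * a + beta x,
      convex_affine phi & convex_affine beta].
Proof.
have [k kP] := choice fibre_affine.
pose tau x := (k x).1; pose beta x := (k x).2.
have tau0 x : 0 < tau x by case: (kP x).
have tauN0 x : tau x != 0 by rewrite gt_eqF.
have psiE x a : psi x a = tau x * a + beta x by case: (kP x).
(* Coefficients are compared by taking the heights [(0, 0)], [(1, 0)] and [(0, 1)]. *)
have seg p q t : p != q -> 0 <= t <= 1 ->
    exists s, let z := t *: p + (1 - t) *: q in
    [/\ phi z = s *: phi p + (1 - s) *: phi q,
        tau z * t = s * tau p, tau z * (1 - t) = (1 - s) * tau q &
        beta z = s * beta p + (1 - s) * beta q].
  move=> pq t01; have [s _ [phiz psiz]] := psi_segment pq t01; exists s => z.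
  have := psiz 0 0; have := psiz 1 0; have := psiz 0 1; rewrite !psiE -/z.
  by split => //; lra.
(* The two coefficient relations become [t / tau p = s / tau z] and
   [(1 - t) / tau q = (1 - s) / tau z]; their sum no longer contains [s]. *)
have harmonic p q t : p != q -> 0 <= t <= 1 ->
    (tau (t *: p + (1 - t) *: q))^-1 = t / tau p + (1 - t) / tau q.
  move=> pq t01; have [s [_ h1 h2 _]] := seg p q t pq t01.
  set z := t *: p + _ in h1 h2 *.
  have -> : t / tau p = s / tau z by apply/eqP; rewrite eqr_div// mulrC h1.
  have -> : (1 - t) / tau q = (1 - s) / tau z.
    by apply/eqP; rewrite eqr_div// mulrC h2.
  by field; exact: tauN0.
have tau_ge p q : tau q <= tau p.
  rewrite leNgt; apply/negP => tpq.
  have pq : q != p by apply: contraTneq tpq => ->; rewrite ltxx.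
  (* This t makes 1 / tau vanish at r. *)
  pose t := 1 - tau p / tau q.
  have t0 : 0 < t by rewrite subr_gt0 ltr_pdivrMr// mul1r.
  have t1 : t < 1 by rewrite ltrBlDr ltrDl divr_gt0.
  pose r := t^-1 *: (q - (1 - t) *: p).
  have rE : t *: r + (1 - t) *: p = q.
    by rewrite scalerA divff ?gt_eqF// scale1r subrK.
  have rp : r != p.
    apply: contra_neq pq => rp.
    by rewrite -rE rp -scalerDl addrC subrK scale1r.
  have := harmonic r p t rp; rewrite rE !ltW// => /(_ isT).
  have -> : (1 - t) / tau p = (tau q)^-1 by rewrite /t; field; rewrite !tauN0.
  have : 0 < t / tau r by rewrite divr_gt0.
  lra.
have tauE p q : tau p = tau q by apply/eqP; rewrite eq_le !tau_ge.
have [x0 _] := X_neq0.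
have affine p q t : 0 <= t <= 1 ->
    phi (t *: p + (1 - t) *: q) = t *: phi p + (1 - t) *: phi q /\
    beta (t *: p + (1 - t) *: q) = t * beta p + (1 - t) * beta q.
  move=> t01; have [->|pq] := eqVneq p q.
    have t1 : t + (1 - t) = 1 by rewrite addrC subrK.
    split; first by rewrite -!scalerDl t1 !scale1r.
    by rewrite -mulrDl -scalerDl t1 scale1r mul1r.
  have [s [h1 h2 _ h3]] := seg p q t pq t01.
  have st : s = t.
    by apply: (mulIf (tauN0 p)); rewrite -h2 mulrC; congr (_ * _); exact: tauE.
  by rewrite h1 h3 st.
exists (tau x0), beta; split => // [x a|p q t t01|p q t t01].
- by rewrite psiE (tauE x x0).
- by case: (affine p q t t01).
- by case: (affine p q t t01).
Qed.

End fibre_maps.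

(** * Order isomorphisms *)

(** After subtracting [A 0], segments from 0 give homogeneity for [t] in [0, 1], inverses extend it
    to [t > 1], midpoints give additivity, and additivity gives negative scalars. *)
Lemma convex_affine_linear (R : realType) (Y Z : lmodType R) (A : Y -> Z) :
  convex_affine A -> exists L : {linear Y -> Z}, forall y, A y = L y + A 0.
Proof.
move=> cA; pose L y := A y - A 0.
have L0 : L 0 = 0 by rewrite /L subrr.
have LC x y (t : R) : 0 <= t <= 1 ->
    L (t *: x + (1 - t) *: y) = t *: L x + (1 - t) *: L y.
  move=> t01; rewrite /L cA// !scalerBr addrACA -opprD -scalerDl.
  by rewrite [t + _]addrC subrK scale1r.
have LZ1 (t : R) x : 0 <= t <= 1 -> L (t *: x) = t *: L x.
  by move=> t01; have := LC x 0 t t01; rewrite L0 !scaler0 !addr0.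
have LZ0 (t : R) x : 0 <= t -> L (t *: x) = t *: L x.
  move=> t0; have [t1|t1] := leP t 1; first by rewrite LZ1// t0.
  have tN0 : t != 0 by rewrite gt_eqF// (lt_trans ltr01).
  rewrite -[x in RHS](scalerK tN0) (LZ1 t^-1) ?scalerA ?divff ?scale1r//.
  by rewrite invr_ge0 t0 invf_le1 ?ltW// (lt_trans ltr01).
have LD x y : L (x + y) = L x + L y.
  have h : (1 - 2^-1 : R) = 2^-1 by lra.
  have := LC x y 2^-1; rewrite h -!scalerDr => /(_ _)/(congr1 ( *:%R 2)).
  rewrite -LZ0// !scalerA divff// !scale1r; apply.
  by rewrite invr_ge0 ler0n invf_le1 ?ler1n ?ltr0n.
have LN x : L (- x) = - L x.
  by apply/eqP; rewrite -addr_eq0 -LD addrC subrr L0.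
have LZ (t : R) x : L (t *: x) = t *: L x.
  have [t0|/ltW t0] := leP 0 t; first exact: LZ0.
  by rewrite -[t]opprK scaleNr LN LZ0 ?oppr_ge0// [in RHS]scaleNr.
have Llin : linear L by move=> t x y; rewrite LD LZ.
pose L' : {linear Y -> Z} := HB.pack L (GRing.isLinear.Build _ _ _ _ L Llin).
by exists L' => y; rewrite /= /L subrK.
Qed.

Section order_isomorphism.
Context {R : realType} {X : normedModType R}.

Definition point (x : X) (a : R) : convex_lsc X :=
  segment_convex_lsc (fun _ : x = x => erefl a).

Lemma pointE x a : point x a x = a%:E.
Proof.
have {2}-> : x = segment_point x x 1.
  by rewrite /segment_point scale1r subrr scale0r addr0.
rewrite [LHS]segment_funE ?lexx ?ler01//.
by congr EFin; ring.
Qed.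

Lemma point_fin x a z : (point x a z < +oo)%E -> z = x.
Proof.
move=> /segment_fun_fin[t _ ->].
by rewrite /segment_point -scalerDl addrC subrK scale1r.
Qed.

Lemma le_point f x a : pointwise_le f (point x a) <-> (f x <= a%:E)%E.
Proof.
split=> [/(_ x)|fx z]; first by rewrite pointE.
have [/point_fin ->|] := ltP (point x a z) +oo%E; first by rewrite pointE.
exact/le_trans/leey.
Qed.

(** A majorant can be finite only at [x], and properness makes it finite there. *)
Lemma ge_point x a h : pointwise_le (point x a) h -> exists b, h = point x b.
Proof.
move=> ah; have hfin z : (h z < +oo)%E -> z = x.
  by move=> hz; apply: (@point_fin _ a); exact: le_lt_trans (ah z) hz.
have [z hz] := convex_lsc_proper h.
have zx := hfin z hz; move: hz; rewrite {}zx => hx.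
have := convex_lsc_gtNy h x; case hxE : (h x) hx => [b| |]// _ _.
exists b; apply: convex_lsc_ext => y.
have [/hfin ->|] := ltP (h y) +oo%E; first by rewrite pointE.
rewrite leye_eq => /eqP hy; rewrite hy; apply/esym/eqP; rewrite -leye_eq leNgt.
by apply/negP => /point_fin yx; rewrite yx hxE in hy.
Qed.

Lemma point_inj x a y b : point x a = point y b -> x = y /\ a = b.
Proof.
move=> e; have xy : x = y by apply: (@point_fin _ b); rewrite -e pointE ltry.
by split=> //; apply: EFin_inj; rewrite -(pointE x) e xy pointE.
Qed.

Lemma pointwise_le_refl (f : convex_lsc X) : pointwise_le f f.
Proof. by move=> x; exact: lexx. Qed.

Lemma pointwise_le_anti (f g : convex_lsc X) :
  pointwise_le f g -> pointwise_le g f -> f = g.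
Proof.
by move=> fg gf; apply: convex_lsc_ext => x; apply/eqP; rewrite eq_le fg gf.
Qed.

(** If [f] is finite at [x] and [z], the one-point functions through its two values are majorants of
    [f]; comparability forces [x = z]. The criterion uses the order alone, so isomorphisms preserve
    it. *)
Lemma point_chain (f : convex_lsc X) :
  (exists x a, f = point x a) <->
  (forall h k, pointwise_le f h -> pointwise_le f k ->
    pointwise_le h k \/ pointwise_le k h).
Proof.
split=> [[x [a ->]] h k /ge_point[b ->] /ge_point[c ->]|chain].
  by rewrite !le_point !pointE !lee_fin; apply/orP; exact: le_total.
have [x fx] := convex_lsc_proper f.
have := convex_lsc_gtNy f x; case fxE : (f x) fx => [a| |]// _ _.
exists x, a; apply: convex_lsc_ext => z.
have [fz|] := ltP (f z) +oo%E; last first.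
  rewrite leye_eq => /eqP fz; rewrite fz; apply/esym/eqP; rewrite -leye_eq leNgt.
  by apply/negP => /point_fin zx; rewrite zx fxE in fz.
suff -> : z = x by rewrite pointE.
have := convex_lsc_gtNy f z; case fzE : (f z) fz => [b| |]// _ _.
have fx : pointwise_le f (point x a) by apply/le_point; rewrite fxE.
have fz : pointwise_le f (point z b) by apply/le_point; rewrite fzE.
have [] := chain _ _ fx fz.
- by rewrite le_point => /le_lt_trans/(_ (ltry _))/point_fin.
- by rewrite le_point => /le_lt_trans/(_ (ltry _))/point_fin ->.
Qed.

Definition order_embedding (T : convex_lsc X -> convex_lsc X) :=
  forall f g, pointwise_le f g <-> pointwise_le (T f) (T g).

Lemma fully_order_preserving_inverse (T : convex_lsc X -> convex_lsc X) :
  fully_order_preserving T ->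
  exists S, [/\ order_embedding S, cancel T S & cancel S T].
Proof.
move=> [/choice[S TS] Tle]; exists S; split => // [f g|f].
  by rewrite [X in _ <-> X]Tle !TS.
by apply: pointwise_le_anti; rewrite Tle TS; exact: pointwise_le_refl.
Qed.

Lemma order_isomorphism_point (T S : convex_lsc X -> convex_lsc X) :
  order_embedding T -> cancel S T ->
  exists (phi : X -> X) (psi : X -> R -> R),
    forall x a, T (point x a) = point (phi x) (psi x a).
Proof.
move=> Tle ST.
have Tpoint x a : exists y b, T (point x a) = point y b.
  apply/point_chain => h k; rewrite -(ST h) -(ST k) -!Tle => xh xk.
  have [chain _] := point_chain (point x a).
  by apply: chain => //; exists x, a.
have [phi phiP] := choice (fun x => Tpoint x 0).
have fibre x :
    exists psi : R -> R, forall a, T (point x a) = point (phi x) (psi a).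
  suff /choice[psi ?] :
      forall a : R, exists b : R, T (point x a) = point (phi x) b.
    by exists psi.
  move=> a.
  have [b Tx0] := phiP x; have [y [c Txa]] := Tpoint x a.
  (* Comparability with [point x 0] forces the same base point for every height [a]. *)
  have [a0|a0] := leP a 0.
    have : pointwise_le (T (point x a)) (T (point x 0)).
      by rewrite -Tle le_point pointE lee_fin.
    rewrite Txa Tx0 => /ge_point[d /point_inj[yx _]].
    by exists c; rewrite yx.
  have : pointwise_le (T (point x 0)) (T (point x a)).
    by rewrite -Tle le_point pointE lee_fin ltW.
  by rewrite Tx0 => /ge_point.
have [psi psiP] := choice fibre.
by exists phi, psi.
Qed.

Section point_maps.
Variables (T S : convex_lsc X -> convex_lsc X).
Variables (phi phi' : X -> X) (psi psi' : X -> R -> R).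
Hypotheses (Tle : order_embedding T) (Sle : order_embedding S)
  (TK : cancel T S) (SK : cancel S T)
  (Tpoint : forall x a, T (point x a) = point (phi x) (psi x a))
  (Spoint : forall x a, S (point x a) = point (phi' x) (psi' x a)).

(** The relation [T f (phi x) = psi x (f x)], phrased through upper bounds so that it also covers
    [f x = +oo]. *)
Lemma point_map_le f x a :
  (T f (phi x) <= (psi x a)%:E)%E = (f x <= a%:E)%E.
Proof. by apply/idP/idP; rewrite -!le_point -Tpoint -Tle. Qed.

Lemma point_mapK : cancel phi phi'.
Proof.
by move=> x; have := TK (point x 0); rewrite Tpoint Spoint => /point_inj[].
Qed.

Lemma fibre_mapK x : cancel (psi x) (psi' (phi x)).
Proof.
by move=> a; have := TK (point x a); rewrite Tpoint Spoint => /point_inj[].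
Qed.

Lemma fibre_map_mono x : {mono psi x : a b / a <= b}.
Proof.
move=> a b; have := point_map_le (point x a) x b.
by rewrite Tpoint !pointE !lee_fin.
Qed.

End point_maps.

(** Convexity is used twice: for the image under [T] of the segment function through [(p, a)] and
    [(q, b)], and for the image under [S] of the one through [(phi p, psi p a)] and
    [(phi q, psi q b)]. They give the two opposite inequalities. *)
Lemma point_map_segment (T S : convex_lsc X -> convex_lsc X)
    (phi phi' : X -> X) (psi psi' : X -> R -> R) p q (s : R) :
  order_embedding T -> order_embedding S -> cancel T S -> cancel S T ->
  (forall x a, T (point x a) = point (phi x) (psi x a)) ->
  (forall x a, S (point x a) = point (phi' x) (psi' x a)) ->
  p != q -> 0 <= s <= 1 ->
  exists2 t, 0 <= t <= 1 &
    phi' (s *: phi p + (1 - s) *: phi q) = t *: p + (1 - t) *: q /\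
    forall a b, psi' (s *: phi p + (1 - s) *: phi q)
        (s * psi p a + (1 - s) * psi q b) = t * a + (1 - t) * b.
Proof.
move=> Tle Sle TK SK Tpt Spt pq s01.
have phiK := point_mapK TK Tpt Spt; have phi'K := point_mapK SK Spt Tpt.
have psiK := fibre_mapK TK Tpt Spt; have psi'K := fibre_mapK SK Spt Tpt.
set Y := s *: phi p + _.
have Phipq : phi p != phi q by rewrite (can_eq phiK).
have pqN (a b : R) : p = q -> a = b by move/eqP: pq.
have PhipqN (a b : R) : phi p = phi q -> a = b by move/eqP: Phipq.
have end1 (u v : X) (a b : R) (h : u = v -> a = b) :
    segment_convex_lsc h u = a%:E.
  have {2}-> : u = segment_point u v 1.
    by rewrite /segment_point scale1r subrr scale0r addr0.
  by rewrite [LHS]segment_funE ?lexx ?ler01//; congr EFin; ring.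
have end0 (u v : X) (a b : R) (h : u = v -> a = b) :
    segment_convex_lsc h v = b%:E.
  have {2}-> : v = segment_point u v 0.
    by rewrite /segment_point scale0r subr0 scale1r add0r.
  by rewrite [LHS]segment_funE ?lexx ?ler01//; congr EFin; ring.
have below a b : (segment_convex_lsc (pqN a b) (phi' Y) <=
    (psi' Y (s * psi p a + (1 - s) * psi q b))%:E)%E.
  rewrite -(point_map_le Tle Tpt) phi'K psi'K.
  apply: econvex_le => //; first exact: convex_lsc_convex.
    by rewrite (point_map_le Tle Tpt) end1.
  by rewrite (point_map_le Tle Tpt) end0.
(* Finiteness at heights 0 already places [phi' Y] on the segment, so [t] does not depend on [a] and
   [b]. *)
have [t t01 vt] := segment_fun_fin (le_lt_trans (below 0 0) (ltry _)).
exists t => //; split => // a b; apply/eqP; rewrite eq_le; apply/andP; split.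
  set g := segment_convex_lsc (PhipqN (psi p a) (psi q b)).
  have Sp : (S g p <= a%:E)%E.
    by rewrite -[p]phiK -[a](psiK p) (point_map_le Sle Spt) end1.
  have Sq : (S g q <= b%:E)%E.
    by rewrite -[q]phiK -[b](psiK q) (point_map_le Sle Spt) end0.
  have SY : (S g (phi' Y) <= (t * a + (1 - t) * b)%:E)%E.
    by rewrite vt; exact: econvex_le (@convex_lsc_convex _ _ (S g)) t01 Sp Sq.
  have psiK' c : psi' Y (psi (phi' Y) c) = c by rewrite -{1}[Y]phi'K psiK.
  have gY : g Y = (s * psi p a + (1 - s) * psi q b)%:E.
    exact: (segment_funE (PhipqN _ _) s01).
  move: SY; rewrite -[X in (_ <= X%:E)%E]psiK' (point_map_le Sle Spt) gY
    lee_fin.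
  by rewrite -(fibre_map_mono Sle Spt Y) psiK'.
by rewrite -lee_fin -(segment_funE (pqN a b) t01) -vt; exact: below.
Qed.

End order_isomorphism.

Lemma fully_order_preserving_affine (R : realType) (X : normedModType R)
    (T : convex_lsc X -> convex_lsc X) :
  (exists x : X, x != 0) -> fully_order_preserving T ->
  exists (c : X) (w : {linear X -> R^o}) (beta tau : R) (E : {linear X -> X}),
    [/\ 0 < tau, bijective E & forall (f : convex_lsc X) (x : X),
      T f x = (tau%:E * f (E x + c)%R + (w x)%:E + beta%:E)%E].
Proof.
move=> X_neq0 FT; have [S [Sle TK SK]] := fully_order_preserving_inverse FT.
have [_ Tle] := FT.
have [phi [psi Tpt]] := order_isomorphism_point Tle SK.
have [phi' [psi' Spt]] := order_isomorphism_point Sle TK.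
have phiK := point_mapK TK Tpt Spt; have phi'K := point_mapK SK Spt Tpt.
have psiK := fibre_mapK TK Tpt Spt.
(* [point_map_segment] describes the inverse maps, so it is applied with [T] and [S] exchanged, at
   [phi p] and [phi q]. *)
have psi_segment p q (t : R) : p != q -> 0 <= t <= 1 ->
  exists2 s : R, 0 <= s <= 1 &
    phi (t *: p + (1 - t) *: q) = s *: phi p + (1 - s) *: phi q /\
    forall a b : R, psi (t *: p + (1 - t) *: q) (t * a + (1 - t) * b) =
      s * psi p a + (1 - s) * psi q b.
  move=> pq t01.
  have Phipq : phi p != phi q by rewrite (can_eq phiK).
  have [s s01 []] := point_map_segment Sle Tle SK TK Spt Tpt Phipq t01.
  rewrite !phiK => phiz psiz; exists s => //; split => // a b.
  by have := psiz (psi p a) (psi q b); rewrite !psiK.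
have [tau [b [tau0 psiE aphi ab]]] := fibre_maps_affine X_neq0 (can_inj phiK)
  (fibre_map_mono Tle Tpt) psi_segment.
have aphi' : convex_affine phi'.
  by move=> x y t t01; apply: (can_inj phiK); rewrite phi'K aphi// !phi'K.
have [E phi'E] := convex_affine_linear aphi'.
have abphi' : convex_affine (b \o phi').
  by move=> x y t t01; rewrite /= aphi'// ab.
have [w wE] := convex_affine_linear abphi'.
(* The value of [T f] at [x] is governed by the base point [phi' x]; hence [E] and [c] come from
   [phi'], while [w] and the constant come from [b \o phi']. *)
exists (phi' 0), w, (b (phi' 0)), tau, E; split => //.
  exists (fun y => phi (y + phi' 0)) => [x|y]; first by rewrite -phi'E phi'K.
  by apply: (addIr (phi' 0)); rewrite -phi'E phiK.
move=> f x; rewrite -phi'E -addeA -EFinD -[(w x + _)%R]wE /=.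
set z := phi' x; have phiz : phi z = x by exact: phi'K.
have Tle_f a : (T f x <= (tau * a + b z)%:E)%E = (f z <= a%:E)%E.
  by rewrite -psiE -(point_map_le Tle Tpt f z a) phiz.
(* Every real [r] is a height [psi z a], so all real bounds on [T f x] are known, which determines
   its value, [+oo] included. *)
have Tle_fr r : (T f x <= r%:E)%E = (f z <= ((r - b z) / tau)%:E)%E.
  by rewrite -Tle_f; congr (_ <= EFin _)%E; field; rewrite gt_eqF.
have := convex_lsc_gtNy f z; case fz : (f z) => [a| |]// _.
- have Tfx : (T f x <= (tau * a + b z)%:E)%E by rewrite Tle_f fz.
  have := convex_lsc_gtNy (T f) x.
  case Tfr : (T f x) Tfx => [r| |]//; rewrite lee_fin => ra _.
  rewrite -EFinM -EFinD; congr EFin; apply/eqP; rewrite eq_le ra /=.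
  have : (T f x <= r%:E)%E by rewrite Tfr.
  by rewrite Tle_fr fz lee_fin ler_pdivlMr// lerBrDr mulrC.
- rewrite gt0_muley ?lte_fin// addye//.
  have := convex_lsc_gtNy (T f) x; case Tfr : (T f x) => [r| |]// _.
  have : (T f x <= r%:E)%E by rewrite Tfr.
  by rewrite Tle_fr fz.
Qed.

(** * Continuity of the linear parts *)

Lemma continuous_convex_lsc (R : realType) (X : normedModType R) (h : X -> R) :
  continuous h ->
  (forall x y (t : R), 0 <= t <= 1 ->
    h (t *: x + (1 - t) *: y) <= t * h x + (1 - t) * h y) ->
  exists f : convex_lsc X, forall x, f x = (h x)%:E.
Proof.
move=> ch hconv; pose f x := (h x)%:E.
have fNy x : (-oo < f x)%E by rewrite ltNyr.
have fp : exists x, (f x < +oo)%E by exists 0; rewrite ltry.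
have fc : econvex_function f.
  by move=> x y t t01; rewrite -!EFinM -EFinD lee_fin hconv.
have fl : lower_semicontinuous f.
  apply/lower_semicontinuousP => a.
  rewrite (_ : mkset _ = h @^-1` [set s | a < s]).
    by apply: (@open_comp X R h); [move=> x _; exact: ch | exact: open_gt].
  by apply/seteqP; split=> x; rewrite /= lte_fin.
by exists (ConvexLsc fNy fp fc fl).
Qed.

(** Semicontinuity at 0 gives [w > -1] on a ball; symmetry of the ball turns this into a two-sided
    bound. *)
Lemma lower_semicontinuous_linear (R : realType) (X : normedModType R)
    (w : {linear X -> R^o}) (beta : R) :
  lower_semicontinuous (fun x => (w x)%:E + beta%:E)%E -> continuous w.
Proof.
move=> /(_ 0 (beta - 1)) [|V V0 wV].
  by rewrite linear0 add0e lte_fin; lra.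
have /nbhs_ballP[r r0 rV] := V0.
apply: bounded_linear_continuous; apply/ex_bound; exists 1.
apply/nbhs_ballP; exists r => //= y yr.
have wy z : ball (0 : X) r z -> - 1 < w z.
  by move=> /rV/wV; rewrite -EFinD lte_fin; lra.
have := wy _ yr; have := wy (- y); rewrite linearN => wNy wy'.
rewrite /= ler_norml; apply/andP; split; first exact: ltW.
rewrite -lerN2 ltW// wNy// -ball_normE /= sub0r opprK.
by move: yr; rewrite -ball_normE /= sub0r normrN.
Qed.

Lemma ereal_affineK (R : realType) (k v b : R) (y : \bar R) :
  0 < k -> (-oo < y)%E ->
  ((k^-1)%R%:E * (k%:E * y + v%:E + b%:E) + (- (v + b) / k)%R%:E = y)%E.
Proof.
move=> k0; case: y => [r| |]// _.
  rewrite -[LHS]/(EFin (k^-1 * (k * r + v + b) + - (v + b) / k)).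
  by congr EFin; field; rewrite gt_eqF.
by rewrite gt0_muley ?lte_fin// !addye// gt0_muley ?lte_fin ?invr_gt0// addye.
Qed.

Lemma ereal_affineKV (R : realType) (k v b : R) (y : \bar R) :
  0 < k -> (-oo < y)%E ->
  (k%:E * ((k^-1)%R%:E * y + (- (v + b) / k)%R%:E) + v%:E + b%:E = y)%E.
Proof.
move=> k0; case: y => [r| |]// _.
  rewrite -[LHS]/(EFin (k * (k^-1 * r + - (v + b) / k) + v + b)).
  by congr EFin; field; rewrite gt_eqF.
by rewrite gt0_muley ?lte_fin ?invr_gt0// addye// gt0_muley ?lte_fin// !addye.
Qed.

Lemma order_preserving_continuous (R : realType) (X : completeNormedModType R)
    (T : convex_lsc X -> convex_lsc X) (c : X) (w : {linear X -> R^o})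
    (beta tau : R) (E : {linear X -> X}) :
  0 < tau ->
  (forall (f : convex_lsc X) x,
    T f x = (tau%:E * f (E x + c)%R + (w x)%:E + beta%:E)%E) ->
  continuous w /\ continuous E.
Proof.
move=> tau0 TE.
have cw : continuous w.
  have [|x y t _|z zE] := @continuous_convex_lsc R X (cst 0).
  - exact: cst_continuous.
  - by rewrite /= !mulr0 addr0.
  apply: (@lower_semicontinuous_linear _ _ _ beta).
  suff -> : (fun x => (w x)%:E + beta%:E)%E = T z by exact: convex_lsc_lsc.
  by apply/funext => x; rewrite TE zE /= mule0 add0e.
split => //.
have [|x y t /andP[t0 t1]|n nE] := @continuous_convex_lsc R X (fun x => `|x|).
- exact: norm_continuous.
- rewrite (le_trans (ler_normD _ _))// !normrZ ger0_norm// ger0_norm//.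
  by rewrite subr_ge0.
apply: (@closed_norm_continuous _ _ _ c) => a.
(* Solving the formula for [T n] expresses the norm of [E x + c] through [T n] and the continuous
   [u]; it is thus lower semicontinuous and its sublevel sets are closed. *)
pose u x : R := - (w x + beta) / tau.
have cu : continuous u.
  move=> x; apply: cvgMr_tmp; apply: cvgN; apply: cvgD; first exact: cw.
  exact: cvg_cst.
have normE x : ((tau^-1)%R%:E * T n x + (u x)%:E = `|E x + c|%:E)%E.
  by rewrite TE nE; apply: ereal_affineK; rewrite // ltNyr.
have itau0 : 0 < tau^-1 by rewrite invr_gt0.
have cid : continuous (id : X -> X) by move=> x; exact: cvg_id.
have /lower_semicontinuousP/(_ a)/open_closedC :=
  lower_semicontinuous_affine_change cid cu itau0 (@convex_lsc_lsc _ _ (T n)).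
congr closed; apply/seteqP; split=> x /=; rewrite normE lte_fin leNgt.
  by move/negP.
by move=> ?; apply/negP.
Qed.

Theorem theorem1 (R : realType) (X : completeNormedModType R)
    (X_neq0 : exists x : X, x != 0)
    (T : convex_lsc X -> convex_lsc X) :
  fully_order_preserving T <->
  exists (c : X) (w : {linear X -> R^o}) (beta tau : R) (E : {linear X -> X}),
    [/\ continuous w, 0 < tau, continuous_automorphism E &
      forall (f : convex_lsc X) (x : X),
        T f x = (tau%:E * f (E x + c)%R + (w x)%:E + beta%:E)%E].
Proof.
split=> [FT|[c [w [beta [tau [E [cw tau0 [cE bE] TE]]]]]]].
  have [c [w [beta [tau [E [tau0 bE TE]]]]]] :=
    fully_order_preserving_affine X_neq0 FT.
  have [cw cE] := order_preserving_continuous tau0 TE.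
  by exists c, w, beta, tau, E.
have [E0 EK0 E0K] := bE.
pose E' : {linear X -> X} :=
  HB.pack E0 (GRing.isLinear.Build _ _ _ _ E0 (can2_linear EK0 E0K)).
have EK : cancel E E' := EK0; have E'K : cancel E' E := E0K.
have cE' : continuous E' := bounded_inverse cE EK E'K.
split=> [g|f g].
  (* [A] inverts the map sending [x] to [E x + c]; solving [T f = g] for [f] gives the scale
     [tau^-1] and the correction [u]. *)
  pose A x := E' (x - c); pose u x : R^o := - (w (A x) + beta) / tau.
  have cA : continuous A.
    move=> x; apply: (@continuous_comp _ _ _ (fun x => x - c) E').
      by apply: cvgB; [exact: cvg_id|exact: cvg_cst].
    exact: cE'.
  have cu : continuous u.
    move=> x; apply: cvgMr_tmp; apply: cvgN; apply: cvgD; last exact: cvg_cst.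
    by apply: (@continuous_comp _ _ _ A w); [exact: cA|exact: cw].
  have aA : convex_affine A.
    move=> x y t _; rewrite /A -!linearZ -linearD; congr (E' _).
    rewrite !scalerBr addrACA; congr (_ + _).
    by rewrite -opprD -scalerDl addrC subrK scale1r.
  have au : convex_affine u.
    move=> x y t t01; rewrite /u aA// [w (_ + _)]linearD ![w (_ *: _)]linearZ.
    have distr (a b : R) : - (t * a + (1 - t) * b + beta) / tau =
        t * (- (a + beta) / tau) + (1 - t) * (- (b + beta) / tau).
      by field; rewrite gt_eqF.
    exact: (distr (w (A x)) (w (A y))).
  have [||f fE] := @affine_change R X A u tau^-1 g cA cu _ aA au.
  - by rewrite invr_gt0.
  - by move=> y; exists (E y + c); rewrite /A addrK.
  exists f; apply: convex_lsc_ext => x; rewrite TE fE /u /A addrK EK.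
  exact: ereal_affineKV tau0 (convex_lsc_gtNy g x).
split=> fg x.
  rewrite !TE; rewrite leeD2r// leeD2r//; apply: lee_wpmul2l (fg _).
  by rewrite lee_fin ltW.
(* At this point the argument [E _ + c] equals [x]. *)
have := fg (E' (x - c)); rewrite !TE E'K subrK.
by rewrite -!addeA -EFinD leeD2rE// lee_pmul2l.
Qed.
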